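(* Let $k$ be a field, $G$ a group, $R=kG$ graded by $R_\tau=k\tau$ ($\tau\in G$), $\gamma\in G$, and $\chi\colon G\to k^\times$ a group homomorphism. Put $\sigma(\tau)=\chi(\tau)\gamma\tau\gamma^{-1}$ for $\tau\in G$. \begin{enumerate} \item[(1)] $\sigma$ extends to a $k$-algebra automorphism of $kG$ with $\sigma(R_\tau)=R_{\gamma\tau\gamma^{-1}}$ for all $\tau\in G$. \item[(2)] The $k$-linear $\sigma$-derivations $\delta$ of $kG$ for which $(\sigma,\delta)$ is $\gamma$-compatible are exactly the $k$-linear maps $\delta_c$ given by $\delta_c(\tau)=c(\tau)\gamma\tau$ ($\tau\in G$) with $c\in Z^1(G,k_\chi)$. \item[(3)] For $c\in Z^1(G,k_\chi)$, $\delta_c$ is $\gamma$-inner if and only if $c\in B^1(G,k_\chi)$. \item[(4)] For $c\in Z^1(G,k_\chi)$, $\sigma\delta_c\sigma^{-1}-\delta_c=-\delta_{c(\gamma)\gamma}$, where for $u\in kG$, $\delta_u(r)=ur-\sigma(r)u$ (so $\delta_{c(\gamma)\gamma}$ is $\delta_u$ for the element $u=c(\gamma)\gamma\in kG$). In particular $\sigma\delta_c\sigma^{-1}-\delta_c$ is $\gamma$-inner. \end{enumerate}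
   Context: $Z^1(G,k_\chi)$ is the $k$-space of maps $c\colon G\to k$ with $c(\tau\rho)=c(\tau)+\chi(\tau)c(\rho)$ for all $\tau,\rho\in G$; $B^1(G,k_\chi)$ is the subspace of maps $\tau\mapsto x(\chi(\tau)-1)$ with $x\in k$. A $\sigma$-derivation of a ring $R$ (with $\sigma$ a ring endomorphism) is an additive map $\delta\colon R\to R$ with $\delta(rs)=\delta(r)s+\sigma(r)\delta(s)$. The pair $(\sigma,\delta)$ on a $G$-graded ring $R$ is $\gamma$-compatible if $\sigma(R_\tau)\subseteq R_{\gamma\tau\gamma^{-1}}$ and $\delta(R_\tau)\subseteq R_{\gamma\tau}$ for all $\tau\in G$. A $\sigma$-derivation is $\gamma$-inner if it equals $\delta_u$, $\delta_u(r)=ur-\sigma(r)u$, for some $u\in R_\gamma$. *)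

(* Defs.v *)
From HB Require Import structures.
From mathcomp Require Import all_boot all_algebra.
From mathcomp Require Import finmap monalg.

Set Implicit Arguments.
Unset Strict Implicit.
Unset Printing Implicit Defensive.

Import GRing.Theory.

Local Open Scope fset_scope.
Local Open Scope ring_scope.

(* {malg k[G]} is the free k-module on G, of finitely supported functions
   G -> k.  monalg equips it with a product only for G : monomType, a structure
   whose sole invertible element is 1, hence the construction below. *)
Definition group_algebra (k : comNzRingType) (G : groupType) : Type :=
  {malg k[G]}.

Section GroupAlgebra.
Variables (k : comNzRingType) (G : groupType).
Local Notation kG := (group_algebra k G).
Implicit Types (r s : kG) (t : G) (D : {fset G}).

HB.instance Definition _ := GRing.Lmodule.copy kG {malg k[G]}.

Definition ga_one : kG := << 1%g >>.

Definition ga_mul r s : kG :=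
  \sum_(t1 <- msupp r) \sum_(t2 <- msupp s) << r@_t1 * s@_t2 *g (t1 * t2)%g >>.

Lemma ga_mulw D1 D2 r s : msupp r `<=` D1 -> msupp s `<=` D2 ->
  ga_mul r s = \sum_(t1 <- D1) \sum_(t2 <- D2)
                 << r@_t1 * s@_t2 *g (t1 * t2)%g >>.
Proof.
move=> le1 le2; rewrite /ga_mul (big_fset_incl _ le1) /=.
  apply/eq_bigr=> t1 _; apply/big_fset_incl => // t _ /mcoeff_outdom ->.
  by rewrite mulr0 monalgU0.
by move=> t _ /mcoeff_outdom rt; rewrite big1 // => t' _; rewrite rt mul0r monalgU0.
Qed.

Lemma ga_mul0r : left_zero 0 ga_mul.
Proof. by move=> r; rewrite /ga_mul msupp0 big_seq_fset0. Qed.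

Lemma ga_mulr0 : right_zero 0 ga_mul.
Proof.
by move=> r; rewrite /ga_mul big1 // => t _; rewrite msupp0 big_seq_fset0.
Qed.

Lemma ga_mulDl : left_distributive ga_mul +%R.
Proof.
move=> r1 r2 s.
rewrite (ga_mulw (msuppD_le r1 r2) (fsubset_refl (msupp s))).
rewrite (ga_mulw (fsubsetUl (msupp r1) (msupp r2)) (fsubset_refl (msupp s))).
rewrite (ga_mulw (fsubsetUr (msupp r1) (msupp r2)) (fsubset_refl (msupp s))).
rewrite -big_split /=; apply/eq_bigr=> t1 _.
rewrite -big_split /=; apply/eq_bigr=> t2 _.
by rewrite mcoeffD mulrDl monalgUD.
Qed.

Lemma ga_mulDr : right_distributive ga_mul +%R.
Proof.
move=> r s1 s2.
rewrite (ga_mulw (fsubset_refl (msupp r)) (msuppD_le s1 s2)).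
rewrite (ga_mulw (fsubset_refl (msupp r)) (fsubsetUl (msupp s1) (msupp s2))).
rewrite (ga_mulw (fsubset_refl (msupp r)) (fsubsetUr (msupp s1) (msupp s2))).
rewrite -big_split /=; apply/eq_bigr=> t1 _.
rewrite -big_split /=; apply/eq_bigr=> t2 _.
by rewrite mcoeffD mulrDr monalgUD.
Qed.

Lemma ga_mulUU a b t1 t2 :
  ga_mul << a *g t1 >> << b *g t2 >> = << a * b *g (t1 * t2)%g >>.
Proof. by rewrite (ga_mulw msuppU_le msuppU_le) !big_seq_fset1 !mcoeffUU. Qed.

Lemma ga_mulEl r s :
  ga_mul r s = \sum_(t <- msupp r) ga_mul << r@_t *g t >> s.
Proof.
rewrite {1}[r]monalgE.
exact: (big_morph (ga_mul^~ s) (fun _ _ => ga_mulDl _ _ _) (ga_mul0r _)).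
Qed.

Lemma ga_mulEr r s :
  ga_mul r s = \sum_(t <- msupp s) ga_mul r << s@_t *g t >>.
Proof.
rewrite {1}[s]monalgE.
exact: (big_morph (ga_mul r) (fun _ _ => ga_mulDr _ _ _) (ga_mulr0 _)).
Qed.

Lemma ga_mul1r : left_id ga_one ga_mul.
Proof.
move=> r; rewrite ga_mulEr [RHS]monalgE; apply/eq_bigr=> t _.
by rewrite ga_mulUU mul1r mul1g.
Qed.

Lemma ga_mulr1 : right_id ga_one ga_mul.
Proof.
move=> r; rewrite ga_mulEl [RHS]monalgE; apply/eq_bigr=> t _.
by rewrite ga_mulUU mulr1 mulg1.
Qed.

Lemma ga_mulA : associative ga_mul.
Proof.
move=> r1 r2 r3.
rewrite [ga_mul r1 r2]ga_mulEl.
rewrite [RHS](big_morph (ga_mul^~ _) (fun _ _ => ga_mulDl _ _ _) (ga_mul0r _)).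
rewrite ga_mulEl; apply/eq_bigr=> t1 _.
rewrite [ga_mul r2 r3]ga_mulEl [ga_mul _ r2]ga_mulEr.
rewrite [LHS](big_morph (ga_mul _) (fun _ _ => ga_mulDr _ _ _) (ga_mulr0 _)).
rewrite [RHS](big_morph (ga_mul^~ _) (fun _ _ => ga_mulDl _ _ _) (ga_mul0r _)).
apply/eq_bigr=> t2 _; rewrite ga_mulUU [RHS]ga_mulEr [ga_mul _ r3]ga_mulEr.
rewrite [LHS](big_morph (ga_mul _) (fun _ _ => ga_mulDr _ _ _) (ga_mulr0 _)).
by apply/eq_bigr=> t3 _; rewrite !ga_mulUU mulrA mulgA.
Qed.

Lemma ga_one_neq0 : ga_one != 0.
Proof.
apply/eqP=> /(congr1 (mcoeff (1%g : G))); rewrite mcoeffUU mcoeff0.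
by apply/eqP; rewrite oner_eq0.
Qed.

HB.instance Definition _ := GRing.Zmodule_isNzRing.Build kG
  ga_mulA ga_mul1r ga_mulr1 ga_mulDl ga_mulDr ga_one_neq0.

Lemma ga_scaleU a b t : a *: (<< b *g t >> : kG) = << a * b *g t >>.
Proof. by apply/malgP=> t'; rewrite mcoeffZ !mcoeffU mulrnAr. Qed.

Lemma ga_scaleAl a r s : a *: (r * s) = (a *: r) * s.
Proof.
apply/esym; rewrite [r]monalgE scaler_sumr !mulr_suml scaler_sumr.
apply/eq_bigr=> t _; rewrite [s]monalgE !mulr_sumr scaler_sumr.
apply/eq_bigr=> t' _; rewrite ga_scaleU.
by rewrite /GRing.mul /= !ga_mulUU ga_scaleU mulrA.
Qed.

HB.instance Definition _ := GRing.Lmodule_isLalgebra.Build k kG ga_scaleAl.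

Lemma ga_scaleAr a r s : a *: (r * s) = r * (a *: s).
Proof.
rewrite [r]monalgE !mulr_suml scaler_sumr.
apply/eq_bigr=> t _; rewrite [s]monalgE mulr_sumr !scaler_sumr mulr_sumr.
apply/eq_bigr=> t' _; rewrite ga_scaleU.
by rewrite /GRing.mul /= !ga_mulUU ga_scaleU mulrCA.
Qed.

HB.instance Definition _ := GRing.Lalgebra_isAlgebra.Build k kG ga_scaleAr.

Definition ga_elt t : kG := << t >>.

Lemma ga_eltM t1 t2 : ga_elt (t1 * t2)%g = ga_elt t1 * ga_elt t2.
Proof. by rewrite /GRing.mul /= ga_mulUU mulr1. Qed.

Lemma ga_elt1 : ga_elt 1%g = 1.
Proof. by []. Qed.

Lemma ga_expand r : r = \sum_(t <- msupp r) r@_t *: ga_elt t.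
Proof.
by rewrite {1}[r]monalgE; apply/eq_bigr=> t _; rewrite ga_scaleU mulr1.
Qed.

(* The component R_t = k t of the G-grading of kG. *)
Definition ga_comp t r : Prop := exists a : k, r = a *: ga_elt t.

(* The k-linear map kG -> kG extending f : G -> kG. *)
Definition lin_ext (f : G -> kG) r : kG := \sum_(t <- msupp r) r@_t *: f t.

Lemma lin_extw (f : G -> kG) D r : msupp r `<=` D ->
  lin_ext f r = \sum_(t <- D) r@_t *: f t.
Proof.
move=> le; apply/big_fset_incl => // t _ /mcoeff_outdom ->.
by rewrite scale0r.
Qed.

Lemma lin_ext_is_linear (f : G -> kG) : linear (lin_ext f).
Proof.
move=> a r s; pose D := msupp (a *: r + s) `|` (msupp r `|` msupp s).
have le1 : msupp (a *: r + s) `<=` D := fsubsetUl _ _.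
have le2 : msupp r `<=` D.
  exact: fsubset_trans (fsubsetUl _ _) (fsubsetUr _ _).
have le3 : msupp s `<=` D.
  exact: fsubset_trans (fsubsetUr _ _) (fsubsetUr _ _).
rewrite (lin_extw f le1) (lin_extw f le2) (lin_extw f le3).
rewrite scaler_sumr -big_split /=; apply/eq_bigr=> t _.
by rewrite mcoeffD mcoeffZ scalerDl scalerA.
Qed.

Lemma lin_ext_elt (f : G -> kG) t : lin_ext f (ga_elt t) = f t.
Proof.
by rewrite (lin_extw f msuppU_le) big_seq_fset1 mcoeffUU scale1r.
Qed.

End GroupAlgebra.

Definition is_char (k : fieldType) (G : groupType) (chi : G -> k) : Prop :=
  (forall t, chi t != 0) /\ {morph chi : s t / (s * t)%g >-> s * t}.

Definition cocycle1 (k : fieldType) (G : groupType) (chi c : G -> k) : Prop :=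
  forall s t, c (s * t)%g = c s + chi s * c t.

Definition coboundary1 (k : fieldType) (G : groupType) (chi c : G -> k) : Prop :=
  exists x : k, forall t, c t = x * (chi t - 1).

Section SkewDerivations.
Variables (R : nzRingType) (sigma : R -> R).

(* sigma is meant to be a ring endomorphism. *)
Definition skew_derivation (delta : R -> R) : Prop :=
  {morph delta : r s / r + s} /\
  (forall r s, delta (r * s) = delta r * s + sigma r * delta s).

Definition inner_derivation (u r : R) : R := u * r - sigma r * u.

Variables (G : groupType) (comp : G -> R -> Prop) (gamma : G).

(* comp t is the component R_t of a G-grading of R. *)
Definition compatible (delta : R -> R) : Prop := forall t,
  (forall r, comp t r -> comp (gamma * t * gamma^-1)%g (sigma r)) /\
  (forall r, comp t r -> comp (gamma * t)%g (delta r)).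

Definition gamma_inner (delta : R -> R) : Prop :=
  exists2 u, comp gamma u & delta =1 inner_derivation u.

End SkewDerivations.

Section Twist.
Variables (k : fieldType) (G : groupType) (chi : G -> k) (gamma : G).
Local Notation kG := (group_algebra k G).

Definition twist : kG -> kG :=
  lin_ext (fun t => chi t *: ga_elt k (gamma * t * gamma^-1)%g).

Definition cocycle_map (c : G -> k) : kG -> kG :=
  lin_ext (fun t => c t *: ga_elt k (gamma * t)%g).

End Twist.

(* Main.v *)
Require Import Defs.
From HB Require Import structures.
From mathcomp Require Import all_boot all_algebra.
From mathcomp Require Import finmap monalg.
From mathcomp Require Import ring.

(** A k-linear map on kG is determined by its values on the basis G, and a
    k-bilinear one by its values on pairs of elements of G.  Hence each
    identity in the proposition (multiplicativity of sigma, the twisted Leibniz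
    rule, innerness, the formula for the conjugate of delta_c) amounts to one
    equation between scalars.

    - Multiplicativity of sigma on s and t is multiplicativity of chi.  As chi
      is invariant under conjugation, the twist by chi^-1 and gamma^-1 undoes
      the twist by chi and gamma.
    - If delta maps each R_t to R_(gamma t), then delta t = c(t) gamma t for
      some function c on G, and in

        delta s * t + sigma s * delta t
          = c(s) gamma s t
            + chi(s) c(t) (gamma s gamma^-1) (gamma t)

      both terms are multiples of gamma s t.  Comparing with delta (s t), the
      Leibniz rule on s and t is the cocycle identity.
    - For u = x gamma one has delta_u t = x (1 - chi(t)) gamma t, so inner
      derivations of degree gamma are the delta_c with c a coboundary.
    - Expanding c(gamma t gamma^-1) by the cocycle identity gives
      c(gamma) + chi(gamma) c(t) - chi(t) c(gamma); the conjugate of delta_c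
      is then compared with delta_c on the elements sigma t, which span kG. *)

Set Implicit Arguments.
Unset Strict Implicit.
Unset Printing Implicit Defensive.

Import GRing.Theory.
Local Open Scope ring_scope.

(** * Linear maps on a group algebra *)

Section LinearExtension.
Variables (k : comNzRingType) (G : groupType).
Local Notation kG := (group_algebra k G).
Local Notation elt := (ga_elt k).

Lemma scale_elt_inj (t : G) : injective (fun a : k => a *: elt t).
Proof.
by move=> a b /(congr1 (mcoeff t)); rewrite !ga_scaleU !mcoeffUU !mulr1.
Qed.

Lemma mul_scale_elt (a b : k) (s t : G) :
  (a *: elt s) * (b *: elt t) = (a * b) *: elt (s * t)%g.
Proof. by rewrite -scalerAl -scalerAr scalerA ga_eltM. Qed.

Lemma linear_lin_ext (f : kG -> kG) :
  linear f -> f =1 lin_ext (fun t => f (elt t)).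
Proof.
move=> lf r.
pose F : {linear kG -> kG} := HB.pack f (GRing.isLinear.Build k kG kG *:%R f lf).
rewrite -[f r]/(F r) {1}[r]ga_expand linear_sum /lin_ext.
by apply/eq_bigr => t _; rewrite linearZ.
Qed.

Lemma eq_linear (f g : kG -> kG) : linear f -> linear g ->
  (forall t, f (elt t) = g (elt t)) -> f =1 g.
Proof.
move=> lf lg fg r; rewrite (linear_lin_ext lf) (linear_lin_ext lg).
by rewrite /lin_ext; apply/eq_bigr => t _; rewrite fg.
Qed.

Lemma eq_bilinear (f g : kG -> kG -> kG) :
  (forall s, linear (f^~ s)) -> (forall r, linear (f r)) ->
  (forall s, linear (g^~ s)) -> (forall r, linear (g r)) ->
  (forall s t, f (elt s) (elt t) = g (elt s) (elt t)) ->
  forall r s, f r s = g r s.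
Proof.
move=> f1 f2 g1 g2 fg r s; apply: (eq_linear (f1 s) (g1 s)) => t1.
exact: (eq_linear (f2 _) (g2 _)).
Qed.

Lemma leibniz_basis (sigma delta : {linear kG -> kG}) :
  (forall s t, delta (elt s * elt t)
     = delta (elt s) * elt t + sigma (elt s) * delta (elt t)) ->
  forall r s, delta (r * s) = delta r * s + sigma r * delta s.
Proof.
move=> deltaM r s; pose f x y := delta (x * y).
pose g x y := delta x * y + sigma x * delta y.
rewrite -/(f r s) -/(g r s); move: r s.
apply: eq_bilinear => // [s a r r'|r a s s'|s a r r'|r a s s']; rewrite /f /g.
- by rewrite mulrDl -scalerAl linearP.
- by rewrite mulrDr -scalerAr linearP.
- by rewrite !linearP !mulrDl scalerDr -!scalerAl addrACA.
- by rewrite !linearP !mulrDr scalerDr -!scalerAr addrACA.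
Qed.

Lemma inner_derivation_linear (sigma : {linear kG -> kG}) (u : kG) :
  linear (inner_derivation sigma u).
Proof.
move=> a r s; rewrite /inner_derivation linearP mulrDr mulrDl.
by rewrite -scalerAr -scalerAl scalerBr opprD addrACA.
Qed.

HB.instance Definition _ (sigma : {linear kG -> kG}) (u : kG) :=
  GRing.isLinear.Build k kG kG *:%R (inner_derivation sigma u)
    (inner_derivation_linear sigma u).

End LinearExtension.

HB.instance Definition _ (k : fieldType) (G : groupType) (chi : G -> k) gamma :=
  GRing.isLinear.Build k (group_algebra k G) (group_algebra k G) *:%R
    (twist chi gamma) (lin_ext_is_linear _).

HB.instance Definition _ (k : fieldType) (G : groupType) (gamma : G)
    (c : G -> k) :=
  GRing.isLinear.Build k (group_algebra k G) (group_algebra k G) *:%R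
    (cocycle_map gamma c) (lin_ext_is_linear _).

Section Twist.
Variables (k : fieldType) (G : groupType).
Implicit Types (chi c : G -> k) (s t gamma : G).
Local Notation kG := (group_algebra k G).
Local Notation elt := (ga_elt k).

(** * Characters and cocycles *)

Lemma char1 chi : is_char chi -> chi 1%g = 1.
Proof.
move=> [chi0 chiM]; apply: (mulfI (chi0 1%g)).
by rewrite -chiM mulg1 mulr1.
Qed.

Lemma charV chi t : is_char chi -> chi t^-1%g = (chi t)^-1.
Proof.
move=> hchi; have [chi0 chiM] := hchi; apply: (mulfI (chi0 t)).
by rewrite -chiM mulgV char1 // mulfV.
Qed.

Lemma char_conj chi s t : is_char chi -> chi (s * t * s^-1)%g = chi t.
Proof.
move=> hchi; have [chi0 chiM] := hchi.
by rewrite !chiM charV // mulrAC mulfV // mul1r.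
Qed.

Lemma char_inv chi : is_char chi -> is_char (fun t => (chi t)^-1).
Proof.
move=> [chi0 chiM]; split=> [t|s t]; first by rewrite invr_eq0.
by rewrite chiM invfM.
Qed.

Lemma cocycle_conj chi c s t : is_char chi -> cocycle1 chi c ->
  c (s * t * s^-1)%g = c s + chi s * c t - chi t * c s.
Proof.
move=> hchi hc; have [chi0 chiM] := hchi.
have c1 : c 1%g = 0.
  apply: (addrI (c 1%g)); rewrite addr0.
  by have := hc 1%g 1%g; rewrite mulg1 (char1 hchi) mul1r => <-.
have cV : c s^-1%g = - ((chi s)^-1 * c s).
  apply: (mulfI (chi0 s)); rewrite mulrN mulVKf //.
  by apply/eqP; rewrite -addr_eq0 addrC -hc mulgV c1.
by rewrite !hc chiM cV; field; rewrite chi0.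
Qed.

(** * The automorphism sigma *)

Lemma twist_elt chi gamma t :
  twist chi gamma (elt t) = chi t *: elt (gamma * t * gamma^-1)%g.
Proof. exact: lin_ext_elt. Qed.

Lemma cocycle_map_elt c gamma t :
  cocycle_map gamma c (elt t) = c t *: elt (gamma * t)%g.
Proof. exact: lin_ext_elt. Qed.

Lemma twist_monoid_morphism chi gamma :
  is_char chi -> monoid_morphism (twist chi gamma : kG -> kG).
Proof.
move=> hchi; have [_ chiM] := hchi; split.
  by rewrite -!ga_elt1 twist_elt char1 // scale1r mulg1 mulgV.
apply: eq_bilinear => [s a r r'|r a s s'|s a r r'|r a s s'|s t] /=.
- by rewrite mulrDl -scalerAl linearP.
- by rewrite mulrDr -scalerAr linearP.
- by rewrite linearP mulrDl scalerAl.
- by rewrite linearP mulrDr scalerAr.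
- by rewrite -ga_eltM !twist_elt mul_scale_elt chiM !mulgA mulgVK.
Qed.

(** Twisting by chi' and gamma^-1 undoes the conjugation, and chi' is not
    affected by the conjugation, so the scalars multiply to 1. *)
Lemma twistK chi chi' gamma : is_char chi' -> (forall t, chi t * chi' t = 1) ->
  cancel (twist chi gamma : kG -> kG) (twist chi' gamma^-1%g).
Proof.
move=> hchi' chiK.
apply: (@eq_linear _ _ (twist chi' gamma^-1%g \o twist chi gamma) idfun).
- by move=> a r s /=; rewrite !linearP.
- by [].
- move=> t /=; rewrite twist_elt linearZ /= twist_elt scalerA char_conj // chiK.
  by rewrite scale1r !mulgA mulVg mul1g mulgK.
Qed.

Lemma twistVK chi gamma : is_char chi ->
  cancel (twist (fun t => (chi t)^-1) gamma^-1%g : kG -> kG) (twist chi gamma).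
Proof.
move=> hchi; rewrite -{2}[gamma]invgK; apply: twistK => // t.
by rewrite mulVf //; case: hchi.
Qed.

Lemma twist_comp chi gamma t (r : kG) :
  ga_comp t r -> ga_comp (gamma * t * gamma^-1)%g (twist chi gamma r).
Proof.
by case=> a ->; rewrite linearZ /= twist_elt scalerA; exists (a * chi t).
Qed.

Lemma twist_compE chi gamma t (s : kG) : is_char chi ->
  ga_comp (gamma * t * gamma^-1)%g s <->
  exists2 r : kG, ga_comp t r & s = twist chi gamma r.
Proof.
move=> hchi; have [chi0 _] := hchi; split=> [[a ->]|[r tr ->]]; last first.
  exact: twist_comp.
exists ((a / chi t) *: elt t); first by exists (a / chi t).
by rewrite linearZ /= twist_elt scalerA divfK.
Qed.

(** * Derivations of degree gamma and cocycles *)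

(** The Leibniz rule on a pair of group elements is the cocycle identity, because
    (gamma s gamma^-1) (gamma t) = gamma s t. *)
Lemma skew_derivation_cocycle_map chi gamma c :
  skew_derivation (twist chi gamma : kG -> kG) (cocycle_map gamma c) <->
  cocycle1 chi c.
Proof.
have leibniz s t :
    cocycle_map gamma c (elt s) * elt t
      + twist chi gamma (elt s) * cocycle_map gamma c (elt t)
    = (c s + chi s * c t) *: elt (gamma * (s * t))%g.
  rewrite twist_elt !cocycle_map_elt -{1}[elt t]scale1r !mul_scale_elt mulr1.
  by rewrite scalerDl !mulgA mulgVK.
split=> [[_ dM] s t|hc].
  apply: (@scale_elt_inj _ _ (gamma * (s * t))%g).
  by rewrite -leibniz -dM -ga_eltM cocycle_map_elt.
split=> [r s|]; first by rewrite linearD.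
apply: leibniz_basis => s t.
by rewrite /= leibniz -hc -ga_eltM cocycle_map_elt.
Qed.

Lemma cocycle_map_compatible chi gamma c :
  compatible (twist chi gamma : kG -> kG) (@ga_comp k G) gamma
    (cocycle_map gamma c).
Proof.
move=> t; split=> [r|_ [a ->]]; first exact: twist_comp.
by rewrite linearZ /= cocycle_map_elt scalerA; exists (a * c t).
Qed.

(** The value d t lies on the line spanned by gamma t, so its coefficient at
    gamma t is the value of the function sought. *)
Lemma compatible_cocycle_map chi gamma (d : kG -> kG) : linear d ->
  compatible (twist chi gamma) (@ga_comp k G) gamma d ->
  exists c, d =1 cocycle_map gamma c.
Proof.
move=> ld hd.
exists (fun t => mcoeff (gamma * t)%g (d (elt t))).
apply: (eq_linear ld (lin_ext_is_linear _)) => t.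
rewrite -/(cocycle_map _ _ _) cocycle_map_elt.
have [a ->] : ga_comp (gamma * t)%g (d (elt t)).
  by apply: (hd t).2; exists 1; rewrite scale1r.
by congr (_ *: _); rewrite ga_scaleU mcoeffUU mulr1.
Qed.

Lemma skew_derivation_ext (R : nzRingType) (sigma d d' : R -> R) :
  d =1 d' -> skew_derivation sigma d -> skew_derivation sigma d'.
Proof. by move=> dd' [dD dM]; split=> r s; rewrite -!dd'. Qed.

Lemma compatible_ext (R : nzRingType) (sigma d d' : R -> R)
    (comp : G -> R -> Prop) gamma :
  d =1 d' -> compatible sigma comp gamma d -> compatible sigma comp gamma d'.
Proof.
by move=> dd' hd t; have [ht dt] := hd t; split=> // r; rewrite -dd'; apply: dt.
Qed.

Lemma compatible_derivationE chi gamma (d : kG -> kG) :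
  [/\ linear d, skew_derivation (twist chi gamma) d
    & compatible (twist chi gamma) (@ga_comp k G) gamma d] <->
  exists2 c, cocycle1 chi c & d =1 cocycle_map gamma c.
Proof.
split=> [[ld dd hd]|[c hc dc]].
  have [c dc] := compatible_cocycle_map ld hd; exists c => //.
  exact/skew_derivation_cocycle_map/(skew_derivation_ext dc).
have cd : cocycle_map gamma c =1 d by move=> r; rewrite dc.
split=> [a r s||].
- by rewrite !dc linearP.
- exact/(skew_derivation_ext cd)/skew_derivation_cocycle_map.
- exact/(compatible_ext cd)/cocycle_map_compatible.
Qed.

(** * Inner derivations and coboundaries *)

Lemma inner_derivation_elt chi gamma (x : k) t :
  inner_derivation (twist chi gamma) (x *: elt gamma) (elt t)
  = (x * (1 - chi t)) *: elt (gamma * t)%g.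
Proof.
rewrite /inner_derivation twist_elt -{1}[elt t]scale1r !mul_scale_elt mulr1.
by rewrite mulgVK -scalerBl mulrBr mulr1 (mulrC x).
Qed.

Lemma gamma_inner_coboundary chi gamma c :
  gamma_inner (twist chi gamma : kG -> kG) (@ga_comp k G) gamma
    (cocycle_map gamma c) <->
  coboundary1 chi c.
Proof.
split=> [[_ [x ->] dc]|[x cx]].
  exists (- x) => t; apply: (@scale_elt_inj _ _ (gamma * t)%g).
  by rewrite -cocycle_map_elt dc inner_derivation_elt mulNr -mulrN opprB.
exists (- x *: elt gamma); first by exists (- x).
apply: eq_linear => [||t]; [exact: linearP|exact: inner_derivation_linear|].
by rewrite cocycle_map_elt inner_derivation_elt cx mulNr -mulrN opprB.
Qed.

Lemma inner_derivationN (R : nzRingType) (sigma : R -> R) (u r : R) :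
  inner_derivation sigma (- u) r = - inner_derivation sigma u r.
Proof. by rewrite /inner_derivation mulNr mulrN -opprD. Qed.

(** The formula for the conjugate of delta_c by sigma, evaluated at sigma r so
    that no inverse of sigma occurs and the values on G can be computed. *)
Lemma twist_cocycle_mapB chi gamma c (r : kG) : is_char chi -> cocycle1 chi c ->
  twist chi gamma (cocycle_map gamma c r)
    - cocycle_map gamma c (twist chi gamma r)
  = - inner_derivation (twist chi gamma) (c gamma *: elt gamma)
        (twist chi gamma r).
Proof.
move=> hchi hc; have [_ chiM] := hchi; move: r.
apply: (@eq_linear _ _
  (fun r => twist chi gamma (cocycle_map gamma c r)
              - cocycle_map gamma c (twist chi gamma r))
  (fun r => - inner_derivation (twist chi gamma) (c gamma *: elt gamma)
              (twist chi gamma r))) => [a r s|a r s|t].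
- by rewrite !linearP scalerDr addrACA.
- by rewrite !linearP.
rewrite cocycle_map_elt twist_elt !linearZ /= twist_elt cocycle_map_elt.
rewrite inner_derivation_elt -!scaleNr !scalerA !mulgA -scalerDl.
congr (_ *: _).
by rewrite (cocycle_conj _ _ hchi hc) (char_conj _ _ hchi) chiM; ring.
Qed.

End Twist.

Theorem proposition2p7 (k : fieldType) (G : groupType) (gamma : G)
    (chi : G -> k) (hchi : is_char chi) :
  let kG := group_algebra k G in
  let sigma : kG -> kG := twist chi gamma in
  let delta : (G -> k) -> kG -> kG := cocycle_map gamma in
  [/\ [/\ forall t : G,
            sigma (ga_elt k t) = chi t *: ga_elt k (gamma * t * gamma^-1)%g,
          linear sigma, monoid_morphism sigma, bijective sigma
        & forall (t : G) (s : kG),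
            ga_comp (gamma * t * gamma^-1)%g s <->
            exists2 r : kG, ga_comp t r & s = sigma r],
      forall d : kG -> kG,
        [/\ linear d, skew_derivation sigma d
          & compatible sigma (@ga_comp k G) gamma d] <->
        exists2 c : G -> k, cocycle1 chi c & d =1 delta c,
      forall c : G -> k, cocycle1 chi c ->
        gamma_inner sigma (@ga_comp k G) gamma (delta c) <->
        coboundary1 chi c
    & forall c : G -> k, cocycle1 chi c ->
      forall sigmaV : kG -> kG, cancel sigma sigmaV -> cancel sigmaV sigma ->
        (forall r : kG,
           sigma (delta c (sigmaV r)) - delta c r =
           - inner_derivation sigma (c gamma *: ga_elt k gamma) r) /\
        gamma_inner sigma (@ga_comp k G) gamma
          (fun r => sigma (delta c (sigmaV r)) - delta c r)].
Proof.
move=> kG sigma delta; split.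
- split.
  + by move=> t; apply: twist_elt.
  + exact: lin_ext_is_linear.
  + exact: twist_monoid_morphism.
  + exists (twist (fun t => (chi t)^-1) gamma^-1%g); last exact: twistVK.
    apply: twistK => [|t]; first exact: char_inv.
    by rewrite mulfV //; case: hchi.
  + by move=> t s; apply: twist_compE.
- by move=> d; apply: compatible_derivationE.
- by move=> c _; apply: gamma_inner_coboundary.
- move=> c hc sigmaV _ sigmaVK.
  have conjB r : sigma (delta c (sigmaV r)) - delta c r =
      - inner_derivation sigma (c gamma *: ga_elt k gamma) r.
    by rewrite -{2 3}[r]sigmaVK; apply: twist_cocycle_mapB.
  split=> //; exists (- c gamma *: ga_elt k gamma); first by exists (- c gamma).
  by move=> r; rewrite conjB scaleNr inner_derivationN.
Qed.
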